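(* Let $\mathrm{cl}$ be a closure operator on a finite set $V$ with $|V|=n$, let $r$ be its rank, and let $A$ be a finite alphabet with $|A|\ge 2$. A set of words $I\subseteq A^n$ is an independent set of the solvability graph $\mathrm{G}(\mathrm{cl},A)$ if and only if it is the image of $A^r$ by a coding function for $\mathrm{cl}$ over $A$, i.e. if and only if there is a coding function $f$ for $\mathrm{cl}$ over $A$ with $I=\mathrm{Im}(f)$.
   Context: A closure operator on $V$ is a map $\mathrm{cl}:2^V\to 2^V$ such that, for all $X,Y\subseteq V$: $X\subseteq\mathrm{cl}(X)$; $X\subseteq Y$ implies $\mathrm{cl}(X)\subseteq\mathrm{cl}(Y)$; and $\mathrm{cl}(\mathrm{cl}(X))=\mathrm{cl}(X)$. Its rank is $r=\min\{|b|: b\subseteq V,\ \mathrm{cl}(b)=V\}$. For a family $f=(f_v)_{v\in V}$ of partitions of $A^r$, $f_X$ ($X\subseteq V$) denotes the common refinement of the $f_v$, $v\in X$ (its parts are the nonempty intersections of parts; $f_\emptyset$ has one part). A coding function for $\mathrm{cl}$ over $A$ is a family $f=(f_v)_{v\in V}$ of partitions of $A^r$, each into at most $|A|$ parts, such that $f_X=f_{\mathrm{cl}(X)}$ for all $X\subseteq V$. The parts of each $f_v$ are labelled by $A$: $f_v=\{P_a(f_v):a\in A\}$, where some $P_a(f_v)$ may be empty. For $x\in A^n$ (coordinates indexed by $V$) put $P_x(f_V)=\bigcap_{v\in V}P_{x_v}(f_v)$, and let the image of $f$ be $\mathrm{Im}(f)=\{x\in A^n: P_x(f_V)\neq\emptyset\}$.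 The solvability graph $\mathrm{G}(\mathrm{cl},A)$ is the undirected graph with vertex set $A^n$ in which two words $x,y$ are adjacent if and only if there is no coding function $f$ for $\mathrm{cl}$ over $A$ with $x,y\in\mathrm{Im}(f)$. An independent set is a set of vertices in which any two vertices are non-adjacent.
   Formalization: The set of words I is assumed nonempty: the empty set is vacuously independent but is never the image of a coding function, since A^r is nonempty. *)

(* Defs.v *)
From mathcomp Require Import all_boot.
Set Implicit Arguments. Unset Strict Implicit. Unset Printing Implicit Defensive.

Section Closure.
Variable V : finType.
Implicit Types (cl : {set V} -> {set V}) (X Y b : {set V}).

Definition closure_operator cl : Prop :=
  [/\ forall X, X \subset cl X,
      forall X Y, X \subset Y -> cl X \subset cl Y
    & forall X, cl (cl X) = cl X].

(* The default candidate [set: V] always qualifies for a closure operator. *)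
Definition rank cl : nat := #|[arg min_(b < [set: V] | cl b == [set: V]) #|b| ]|.

End Closure.

Section Partitions.
Variables (V A W : finType).
Implicit Types (f : {ffun V -> {set {set W}}}) (X : {set V}).

(* Ranges over all choices c of one part of f_v for each v in X. *)
Definition refinement f X : {set {set W}} :=
  [set \bigcap_(v in X) c v | c : {ffun V -> {set W}}
                              & [forall v in X, c v \in f v]] :\ set0.

(* Labels may be unused (P a = set0), but a part carries exactly one label. *)
Definition labels (p : {set {set W}}) (P : {ffun A -> {set W}}) : bool :=
  (p == [set P a | a : A] :\ set0) &&
  [forall a, forall b, (P a != set0) && (P a == P b) ==> (a == b)].

Definition labelling f (P : {ffun V -> {ffun A -> {set W}}}) : bool :=
  [forall v, labels (f v) (P v)].

Definition coding_image (P : {ffun V -> {ffun A -> {set W}}}) :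
    {set {ffun V -> A}} :=
  [set x : {ffun V -> A} | \bigcap_(v : V) P v (x v) != set0].

End Partitions.

Section Coding.
Variables (V : finType) (cl : {set V} -> {set V}) (A : finType).

Definition source : finType := {ffun 'I_(rank cl) -> A}.

Definition coding_function (f : {ffun V -> {set {set source}}}) : bool :=
  [&& [forall v, partition (f v) [set: source]],
      [forall v, #|f v| <= #|A| ]
    & [forall X : {set V}, refinement f X == refinement f (cl X)]].

Definition solvability_graph : rel {ffun V -> A} := fun x y =>
  ~~ [exists f : {ffun V -> {set {set source}}},
      exists P : {ffun V -> {ffun A -> {set source}}},
      [&& coding_function f, labelling f P,
          x \in coding_image P & y \in coding_image P]].

Lemma solvability_graph_sym : symmetric solvability_graph.
Proof.
move=> x y; congr (~~ _); apply: eq_existsb => f; apply: eq_existsb => P.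
by rewrite [(x \in _) && _]andbC.
Qed.

Lemma solvability_graph_irr : 0 < #|A| -> irreflexive solvability_graph.
Proof.
case/card_gt0P=> a0 _ x; apply/negbTE; rewrite negbK.
have W0 : [set: source] != set0.
  by apply/set0Pn; exists [ffun=> a0]; rewrite inE.
apply/existsP; exists [ffun=> [set [set: source]]].
apply/existsP; exists [ffun v => [ffun a => if a == x v then setT else set0]].
have xI : x \in coding_image [ffun v => [ffun a =>
    if a == x v then [set: source] else set0]].
  by rewrite inE big1 // => v _; rewrite !ffunE eqxx.
have refE X : refinement [ffun _ : V => [set [set: source]]] X = [set setT].
  apply/setP=> B; rewrite !inE; apply/andP/eqP => [[_ /imsetP[c]]|->].
    rewrite inE => /forall_inP cP ->; apply: big1 => v /cP.
    by rewrite ffunE inE => /eqP.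
  split=> //; apply/imsetP; exists [ffun=> setT].
    by rewrite inE; apply/forall_inP => v _; rewrite !ffunE inE.
  by rewrite big1 // => v _; rewrite ffunE.
apply/and4P; split=> //; last first.
  apply/forallP=> v; rewrite !ffunE; apply/andP; split.
    apply/eqP/setP=> B; rewrite !inE; apply/eqP/andP => [->|[B0]].
      by split=> //; apply/imsetP; exists (x v); rewrite // ffunE eqxx.
    by case/imsetP=> a _ EB; move: B0; rewrite EB ffunE; case: ifP; rewrite ?eqxx.
  apply/forallP=> a; apply/forallP=> b; apply/implyP; rewrite !ffunE.
  case: (a =P x v) => [->|_]; case: (b =P x v) => [->|_]; rewrite ?eqxx //.
  by rewrite (negbTE W0) andbF.
apply/and3P; split.
- apply/forallP=> v; rewrite ffunE /partition /trivIset /cover !big_set1.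
  by rewrite !eqxx /= inE eq_sym.
- by apply/forallP=> v; rewrite ffunE cards1; apply/card_gt0P; exists a0.
- by apply/forallP=> X; rewrite !refE.
Qed.

End Coding.

Definition independent (T : finType) (e : rel T) (I : {set T}) : Prop :=
  {in I &, forall x y, ~~ e x y}.

(* Main.v *)
(** Two words of the image of a coding function that agree on X agree on cl X.
    Since this constrains pairs of words only, it holds on every independent set
    I.  Applied to a basis b, it shows that restriction to b is injective on I,
    so the nonempty set I is the range of some map g from A^r.  The partitions
    of A^r into the fibres of the coordinates of g form a coding function. *)
Require Import Defs.
From mathcomp Require Import all_boot.
Set Implicit Arguments. Unset Strict Implicit. Unset Printing Implicit Defensive.

Lemma rank_basis (V : finType) (cl : {set V} -> {set V}) :
  closure_operator cl -> exists2 b : {set V}, cl b = setT & #|b| = rank cl.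
Proof.
case=> cl_ext _ _; rewrite /rank.
case: arg_minnP => [|b /eqP clb _]; last by exists b.
by rewrite -subTset cl_ext.
Qed.

(** In database terms, [I] is a relation satisfying the functional dependencies from [X] to [cl X].
    Only pairs of words are compared, which matches the edge relation of the solvability graph. *)
Definition agree_closed (V A : finType) (cl : {set V} -> {set V})
    (I : {set {ffun V -> A}}) : Prop :=
  {in I &, forall (x y : {ffun V -> A}) (X : {set V}),
    {in X, x =1 y} -> {in cl X, x =1 y}}.

(** The point [w] makes [P a] nonempty, hence a genuine part, and only one part contains [w]. *)
Lemma labels_block (A W : finType) (p : {set {set W}}) (P : {ffun A -> {set W}})
    (a : A) (B : {set W}) (w : W) :
  partition p setT -> labels p P -> B \in p -> w \in B -> w \in P a -> B = P a.
Proof.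
case/and3P=> _ tIp _ /andP[/eqP defp _] Bp wB wPa.
have Pap : P a \in p by rewrite defp !inE imset_f // andbT; apply/set0Pn; exists w.
by rewrite -(def_pblock tIp Bp wB) (def_pblock tIp Pap wPa).
Qed.

(** Take points [p] and [q] in the cells of [x] and [y]. Agreement on [X] puts both in one part of
    the refinement over [X]. That part is also a part of the refinement over [cl X], so for each [v]
    in [cl X] a single part of [f v] contains [p] and [q], and its label is both [x v] and [y v]. *)
Lemma coding_image_agree_closed (V A : finType) (cl : {set V} -> {set V})
    (f : {ffun V -> {set {set source cl A}}})
    (P : {ffun V -> {ffun A -> {set source cl A}}}) :
  coding_function f -> labelling f P -> agree_closed cl (coding_image P).
Proof.
case/and3P=> /forallP partf _ /forallP codf /forallP labf x y.
rewrite !inE => /set0Pn[p /bigcapP pP] /set0Pn[q /bigcapP qP] X eqX v clXv.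
have pB : p \in \bigcap_(u in X) P u (x u) by apply/bigcapP=> u _; apply: pP.
have qB : q \in \bigcap_(u in X) P u (x u).
  by apply/bigcapP=> u Xu; rewrite (eqX u Xu); apply: qP.
have: \bigcap_(u in X) P u (x u) \in refinement f X.
  rewrite !inE; apply/andP; split; first by apply/set0Pn; exists p.
  apply/imsetP; exists [ffun u => P u (x u)].
    rewrite inE; apply/forall_inP => u _; rewrite ffunE.
    have /andP[/eqP-> _] := labf u; rewrite !inE imset_f // andbT.
    by apply/set0Pn; exists p; apply: pP.
  by apply: eq_bigr => u _; rewrite ffunE.
rewrite (eqP (codf X)) !inE => /andP[_ /imsetP[c]].
rewrite inE => /forall_inP/(_ v clXv) cv defB.
move: pB qB; rewrite defB => /bigcapP/(_ v clXv) pc /bigcapP/(_ v clXv) qc.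
have eqPxy : P v (x v) = P v (y v).
  have block := labels_block (partf v) (labf v) cv.
  by rewrite -(block _ _ pc (pP v isT)) -(block _ _ qc (qP v isT)).
(* Equal blocks have equal labels only if they are nonempty, which [q] guarantees. *)
have /andP[_ /forallP/(_ (x v))/forallP/(_ (y v))/implyP injP] := labf v.
apply/eqP/injP; rewrite eqPxy eqxx andbT.
by apply/set0Pn; exists q; apply: qP.
Qed.

Lemma independent_agree_closed (V A : finType) (cl : {set V} -> {set V})
    (I : {set {ffun V -> A}}) :
  independent (solvability_graph cl (A := A)) I -> agree_closed cl I.
Proof.
move=> indI x y xI yI; have := indI x y xI yI; rewrite negbK.
case/existsP=> f /existsP[P /and4P[codf labf xP yP]].
exact: coding_image_agree_closed codf labf x y xP yP.
Qed.

Lemma agree_closed_onto (V A : finType) (cl : {set V} -> {set V})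
    (I : {set {ffun V -> A}}) :
  closure_operator cl -> agree_closed cl I -> I != set0 ->
  exists g : source cl A -> {ffun V -> A}, I = [set g w | w in source cl A].
Proof.
move=> hcl clI /set0Pn[x0 x0I]; have [b clb card_b] := rank_basis hcl.
(* Restriction to the basis [b], whose elements are enumerated by the ordinals below the rank so
   that the result lies in [source cl A]. *)
pose restr (x : {ffun V -> A}) : source cl A :=
  [ffun i => x (enum_val (cast_ord (esym card_b) i))].
have restr_inj : {in I &, injective restr}.
  move=> x y xI yI eq_xy; apply/ffunP=> v.
  apply: (clI x y xI yI b) => [u ub|]; last by rewrite clb inE.
  have /ffunP/(_ (cast_ord card_b (enum_rank_in ub u))) := eq_xy.
  by rewrite !ffunE cast_ordK enum_rankK_in.
(* A source word that is the restriction of no word of [I] is sent to [x0], which keeps the range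
   inside [I]. *)
exists (fun w => odflt x0 [pick x in I | restr x == w]).
apply/setP=> x; apply/idP/imsetP => [xI|[w _ ->]].
  exists (restr x) => //; case: pickP => [y /andP[yI /eqP eq_yx]|/(_ x)].
    by apply: restr_inj.
  by rewrite xI eqxx.
by case: pickP => [y /andP[]|].
Qed.

Section FibreCoding.
Variables (V A W : finType) (g : W -> {ffun V -> A}).

(** The label of [w] at [v] is the coordinate [g w v], so [w] lies in the cell of the word [g w].
    Values that [g] never takes at [v] give empty fibres, which are discarded only in
    [fibre_partitions]. *)
Definition fibres : {ffun V -> {ffun A -> {set W}}} :=
  [ffun v => [ffun a => [set w | g w v == a]]].

Definition fibre_partitions : {ffun V -> {set {set W}}} :=
  [ffun v => [set fibres v a | a : A] :\ set0].

Lemma in_fibres v a w : (w \in fibres v a) = (g w v == a).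
Proof. by rewrite !ffunE inE. Qed.

Lemma fibre_labelling : labelling fibre_partitions fibres.
Proof.
apply/forallP=> v; rewrite /labels ffunE eqxx /=.
apply/forallP=> a; apply/forallP=> b; apply/implyP.
case/andP=> /set0Pn[w wa] /eqP eq_ab; move: (wa); rewrite eq_ab.
by move: wa; rewrite !in_fibres => /eqP->.
Qed.

Lemma fibre_partition v : partition (fibre_partitions v) setT.
Proof.
rewrite ffunE; apply/and3P; split; last by rewrite !inE eqxx.
  rewrite -subTset; apply/subsetP=> w _; apply/bigcupP.
  exists (fibres v (g w v)); last by rewrite in_fibres.
  rewrite !inE imset_f // andbT.
  by apply/set0Pn; exists w; rewrite in_fibres.
apply/trivIsetP=> _ _ /setD1P[_ /imsetP[a _ ->]] /setD1P[_ /imsetP[b _ ->]].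
apply: contraR => /pred0Pn[w /andP[/=]].
by rewrite !in_fibres => /eqP-> /eqP->.
Qed.

Lemma card_fibre_partitions v : #|fibre_partitions v| <= #|A|.
Proof.
by rewrite ffunE (leq_trans (subset_leq_card (subD1set _ _))) ?leq_imset_card.
Qed.

(** The parts are the classes of the kernel of the map sending [w] to [g w] restricted to [X];
    comparing two refinements thus reduces to comparing two equivalence relations. *)
Lemma fibre_refinement (X : {set V}) :
  refinement fibre_partitions X =
  [set [set w' | [forall v in X, g w' v == g w v]] | w : W].
Proof.
apply/setP=> B; rewrite inE in_set1; apply/andP/imsetP=> [[B0 /imsetP[c]]|[w _ ->]].
  (* A point [w] of the nonempty part [B] forces each chosen part [c v], for [v] in [X], to be the
     fibre through [w]. *)
  rewrite inE => /forall_inP cf defB; have /set0Pn[w wB] := B0.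
  exists w => //; apply/setP=> w'; move: wB; rewrite defB inE => /bigcapP wc.
  apply/bigcapP/forall_inP => w'c v vX; move: (w'c v vX) (wc v vX);
    have := cf v vX; rewrite ffunE => /setD1P[_ /imsetP[a _ ->]];
    by rewrite !in_fibres => /eqP-> /eqP->.
split; first by apply/set0Pn; exists w; rewrite inE; apply/forall_inP.
apply/imsetP; exists [ffun v => fibres v (g w v)].
  rewrite inE; apply/forall_inP=> v _; rewrite ffunE [fibre_partitions v]ffunE.
  by rewrite !inE imset_f // andbT; apply/set0Pn; exists w; rewrite in_fibres.
apply/setP=> w'; rewrite inE.
by apply/forall_inP/bigcapP=> h v /h; rewrite ffunE in_fibres.
Qed.

Lemma coding_image_fibres : coding_image fibres = [set g w | w : W].
Proof.
apply/setP=> x; rewrite inE; apply/set0Pn/imsetP => [[w /bigcapP wx]|[w _ ->]].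
  by exists w => //; apply/ffunP=> v; have := wx v isT; rewrite in_fibres => /eqP.
by exists w; apply/bigcapP=> v _; rewrite in_fibres.
Qed.

End FibreCoding.

Lemma fibre_coding_function (V A : finType) (cl : {set V} -> {set V})
    (g : source cl A -> {ffun V -> A}) :
  closure_operator cl -> agree_closed cl [set g w | w in source cl A] ->
  coding_function (fibre_partitions g).
Proof.
case=> cl_ext _ _ clI; apply/and3P; split; apply/forallP.
- exact: fibre_partition.
- exact: card_fibre_partitions.
move=> X; apply/eqP; rewrite !fibre_refinement; apply: eq_imset => w.
apply/setP=> w'; rewrite !inE; apply/forall_inP/forall_inP => eq_ww' v vX.
  (* Agreement on [X] spreads to [cl X] because both words lie in the range of [g]; the other
     direction is extensivity of [cl]. *)
  apply/eqP; apply: (clI _ _ (imset_f g _) (imset_f g _) X) vX => // u uX.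
  exact/eqP/eq_ww'.
exact/eq_ww'/(subsetP (cl_ext X)).
Qed.

Theorem theorem5 (V : finType) (cl : {set V} -> {set V}) (A : finType)
    (hcl : closure_operator cl) (hA : 2 <= #|A|)
    (I : {set {ffun V -> A}}) (hI : I != set0) :
  independent (solvability_graph cl (A := A)) I <->
  exists (f : {ffun V -> {set {set source cl A}}})
         (P : {ffun V -> {ffun A -> {set source cl A}}}),
    [/\ coding_function f, labelling f P & I = coding_image P].
Proof.
split=> [indI | [f [P [codf labf ->]]] x y xI yI]; last first.
  (* The given [f] and [P] themselves witness that any two words of the image are non-adjacent. *)
  by rewrite negbK; apply/existsP; exists f; apply/existsP; exists P; apply/and4P.
have clI := independent_agree_closed indI.
have [g defI] := agree_closed_onto hcl clI hI; rewrite defI in clI *.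
exists (fibre_partitions g), (fibres g); split.
- exact: fibre_coding_function.
- exact: fibre_labelling.
- by rewrite coding_image_fibres.
Qed.
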